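(* Let $n \ge 2$, let $-1 = \hat x_0 < \hat x_1 < \dots < \hat x_{n-1} < \hat x_n = 1$ be floating point nodes, and let $m := \lfloor (n+1)/2 \rfloor$. Assume that sums can be computed as described in the context, with $\sigma_m$ such that $(20 + 2.02\,\sigma_m)\,\epsilon < 0.01$. If $2 + \hat x_1$, $2 - \hat x_{n-1}$ and $\hat x_i + \hat x_{i-1}$, for $i = 1,\dots,n-1$, are floating point numbers, then, for $t \in [-1,1]$ (not a node) and function values $f = (f_0,\dots,f_n)$, the second barycentric formula $$b_n(t;f) = \frac{\sum_{i=0}^n \frac{\gamma_i f_i}{t - \hat x_i}}{\sum_{i=0}^n \frac{\gamma_i}{t - \hat x_i}}$$ with the simplified weights $\gamma_0 = 1/2$, $\gamma_n = (-1)^n/2$, $\gamma_i = (-1)^i$ for $1 \le i \le n-1$, can be evaluated in floating point arithmetic so that the computed value $\hat b_n(t;f)$ is equal to $b_n(t;\hat f)$ for a vector $\hat f = (\hat f_0,\dots,\hat f_n)$ with $$|\hat f_i - f_i| \le (16.6 + 2.1\,\sigma_m)\, \max\{ |f_{i-1}| + |f_i|,\ |f_i| + |f_{i+1}| \}\, \epsilon \qquad \text{for } i = 0,\dots,n,$$ with the convention $f_{-1} = f_{n+1} = 0$. Moreover, $$|\hat b_n(t;f) - b_n(t;f)| \le \big( 45.6\, \|f\|_\infty + 37.4\, \|\Delta f\|_\infty + 6.2\, \|f\|_\infty \sigma_m + 4.1\, \|\Delta f\|_\infty \sigma_m \big)\, \epsilon,$$ where $\Delta f$ is the vector with entries $\Delta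 f_i = (f_i - f_{i-1})/(\hat x_i - \hat x_{i-1})$, $i = 1,\dots,n$.
   Context: Floating point model. Arithmetic is binary, without overflow or underflow, with machine precision $\epsilon > 0$, $\epsilon \approx 10^{-16}$. For real $\rho \ge 1$ let $\mathcal{E}_\rho = \{ z \in \mathbb{R} : (1-\epsilon)^{\rho} \le z \le (1-\epsilon)^{-\rho} \}$. For floating point numbers $x,y$ and $\mathrm{op} \in \{+,-,*,/\}$, the computed value is $\mathrm{fl}(x \,\mathrm{op}\, y) = (x \,\mathrm{op}\, y) z$ for some $z \in \mathcal{E}_1$; if $x \,\mathrm{op}\, y$ is itself a floating point number then $\mathrm{fl}(x \,\mathrm{op}\, y) = x \,\mathrm{op}\, y$; multiplication of a floating point number by a power of two is exact. Summation assumption. For each $n$, a sum of $n+1$ floating point numbers $a_0,\dots,a_n$ can be computed with result $\hat\sum_{i=0}^n a_i = \sum_{i=0}^n (1 + \delta_i \sigma_n \epsilon)\, a_i$, where $|\delta_i| \le 1$ (the $\delta_i$ may depend on the $a_i$) and $\sigma_n$ may depend on $n$ but not on the $a_i$; moreover $1 \le \sigma_n \le \sigma_{n+1}$. The point $t$, the nodes $\hat x_i$ and the values $f_i$ are floating point numbers. $\|v\|_\infty = \max_i |v_i|$ is the sup norm of a vector. ''Can be evaluated'' means that there is a finite sequence of floating point operations (operations $\mathrm{op} \in \{+,-,*,/\}$ with computed value $\mathrm{fl}(x \,\mathrm{op}\, y)$) and summations (of $N+1$ floating point numbers $a_0,\dots,a_N$, with computed result $\hat\sum_{i=0}^N a_i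 = \sum_{i=0}^N (1 + \delta_i \sigma_N \epsilon)\, a_i$, $|\delta_i| \le 1$) (the choice may depend on $n$ and on the subinterval $(\hat x_k,\hat x_{k+1})$ containing $t$) which in exact arithmetic would return $b_n(t;f)$, and whose computed value has the stated properties. The vector $\hat f$ may depend on $t$. *)

(* Defs.v *)
From mathcomp Require Import all_boot all_order all_algebra.
From mathcomp Require Import classical_sets reals exp.
Set Implicit Arguments.
Unset Strict Implicit.
Unset Printing Implicit Defensive.
Import Order.TTheory GRing.Theory Num.Theory.
Local Open Scope classical_set_scope.
Local Open Scope ring_scope.

Definition Erho (R : realType) (eps rho : R) : set R :=
  [set z | (1 - eps) `^ rho <= z <= (1 - eps) `^ (- rho)].

Inductive fop := Add | Sub | Mul | Div.

Definition exact_op (R : realType) (o : fop) (x y : R) : R :=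
  match o with
  | Add => x + y
  | Sub => x - y
  | Mul => x * y
  | Div => x / y
  end.

(* The set of floating point numbers and the rounding are arbitrary subject to
   the fields below; the computed value may depend on the operation and on both
   operands.  Since x / 0 = 0 in MathComp, the error fields exclude division by
   zero explicitly. *)
Record fp_arith (R : realType) := FPArith {
  eps : R;
  float : set R;
  fl : fop -> R -> R -> R;
  sigma : nat -> R;
  flsum : forall N : nat, ('I_N.+1 -> R) -> R;
  eps_gt0 : 0 < eps;
  float_fl : forall o x y, float x -> float y -> (o = Div -> y <> 0) ->
    float (fl o x y);
  fl_error : forall o x y, float x -> float y -> (o = Div -> y <> 0) ->
    exists2 z, Erho eps 1 z & fl o x y = exact_op o x y * z;
  fl_exact : forall o x y, float x -> float y -> (o = Div -> y <> 0) ->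
    float (exact_op o x y) -> fl o x y = exact_op o x y;
  float_pow2 : forall z : int, float (2 ^ z);
  fl_mul_pow2 : forall x (z : int), float x -> fl Mul x (2 ^ z) = x * 2 ^ z;
  sigma_ge1 : forall N, 1 <= sigma N;
  sigma_nondecreasing : forall N, sigma N <= sigma N.+1;
  float_flsum : forall N (a : 'I_N.+1 -> R),
    (forall i, float (a i)) -> float (flsum a);
  flsum_error : forall N (a : 'I_N.+1 -> R), (forall i, float (a i)) ->
    exists2 delta : 'I_N.+1 -> R, (forall i, `|delta i| <= 1) &
      flsum a = \sum_i (1 + delta i * sigma N * eps) * a i
}.

(* A finite sequence of operations and summations, presented as the expression
   tree of its result.  The inputs are t, x_0, ..., x_n, f_0, ..., f_n; the only
   literal constants are the powers of two. *)
Inductive expr (n : nat) :=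
  | EPow2 of int
  | EPoint
  | ENode of 'I_n.+1
  | EValue of 'I_n.+1
  | EOp of fop & expr n & expr n
  | ESum (N : nat) of ('I_N.+1 -> expr n).

Arguments EPow2 {n}.
Arguments EPoint {n}.

Record arith (R : realType) := Arith {
  arith_op : fop -> R -> R -> R;
  arith_sum : forall N : nat, ('I_N.+1 -> R) -> R
}.

Definition exact_arith (R : realType) : arith R :=
  Arith (@exact_op R) (fun N (a : 'I_N.+1 -> R) => \sum_i a i).

Definition computed_arith (R : realType) (M : fp_arith R) : arith R :=
  Arith (fl M) (@flsum R M).

Fixpoint eval (R : realType) (A : arith R) (n : nat)
    (t : R) (x f : 'I_n.+1 -> R) (e : expr n) : R :=
  match e with
  | EPow2 z => 2 ^ z
  | EPoint => t
  | ENode i => x i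
  | EValue i => f i
  | EOp o e1 e2 => arith_op A o (eval A t x f e1) (eval A t x f e2)
  | ESum N s => arith_sum A (fun i : 'I_N.+1 => eval A t x f (s i))
  end.

(* No division by zero occurs when e is evaluated in the arithmetic A. *)
Fixpoint defined (R : realType) (A : arith R) (n : nat)
    (t : R) (x f : 'I_n.+1 -> R) (e : expr n) : Prop :=
  match e with
  | EOp o e1 e2 => [/\ defined A t x f e1, defined A t x f e2 &
                       o = Div -> eval A t x f e2 <> 0]
  | ESum N s => forall i : 'I_N.+1, defined A t x f (s i)
  | _ => True
  end.

Definition weight (R : realType) (n : nat) (i : 'I_n.+1) : R :=
  if i == 0 :> nat then 1 / 2
  else if i == n :> nat then (-1) ^+ n / 2
  else (-1) ^+ i.

Definition bary (R : realType) (n : nat) (x : 'I_n.+1 -> R) (t : R)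
    (f : 'I_n.+1 -> R) : R :=
  (\sum_(i < n.+1) weight R i * f i / (t - x i)) /
  (\sum_(i < n.+1) weight R i / (t - x i)).

(* f_{i-1} and f_{i+1}, with f_{-1} = f_{n+1} = 0. *)
Definition prev_value (R : realType) (n : nat) (f : 'I_n.+1 -> R)
    (i : 'I_n.+1) : R :=
  if i == 0 :> nat then 0 else f (inord i.-1).

Definition next_value (R : realType) (n : nat) (f : 'I_n.+1 -> R)
    (i : 'I_n.+1) : R :=
  if i == n :> nat then 0 else f (inord i.+1).

Definition sup_norm (R : realType) (d : nat) (v : 'I_d -> R) : R :=
  \big[Num.max/0]_(i < d) `|v i|.

(* The index i : 'I_n stands for i + 1 in 1, ..., n. *)
Definition divided_diff (R : realType) (n : nat) (x f : 'I_n.+1 -> R)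
    (i : 'I_n) : R :=
  (f (inord i.+1) - f (inord i)) / (x (inord i.+1) - x (inord i)).

(* Main.v *)
Require Import Defs.
From mathcomp Require Import all_boot all_order all_algebra.
From mathcomp Require Import classical_sets reals exp.
From mathcomp Require Import zify ring lra.
Set Implicit Arguments.
Unset Strict Implicit.
Unset Printing Implicit Defensive.
Import Order.TTheory GRing.Theory Num.Theory.
Local Open Scope ring_scope.

(** Let t lie strictly between x_k and x_{k+1}, let d_i = |t - x_i|, and
multiply numerator and denominator of the formula by (-1)^k.  On each side of t
the terms of the denominator then alternate in sign and shrink away from t,
starting with a positive one at x_k and at x_{k+1}.  Pairing every positive term
(near node i) with the negative one next to it, away from t (far node j), splits
the nodes into at most m + 1 blocks, the leftover nodes being endpoints.  The
denominator contributed by such a pair is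

  W = 1/d_i - c/d_j = (d_j - c d_i) / (d_i d_j),   c = 1, or 1/2 at an endpoint,

and d_j - c d_i is d_j - d_i = |x_i - x_j| or half of d_j + |x_i - x_j|.  Every
subtraction has input data as operands and every addition has positive operands,
so W is computed with a relative error of at most six roundings
([evaluates_block_weight]).  All the W are positive: summing them loses nothing
to cancellation.  The numerator of the pair is rewritten as

  V = f_i/d_i - c f_j/d_j = f_i W + (f_i - f_j) c/d_j,

where both terms are computed to high relative accuracy ([block_valueP]).  The
identity serves both claims.

Backward error: relative errors a, b of the two terms amount to replacing f_i by
f_i a and f_j by f_j b + f_i (a - b), that is, to errors of order eps in f_i and
f_j relative to |f_i| + |f_j|.  The errors of the summations, of the denominator
and of the division multiply all values of a block by a common factor
([quotient_factor], [backward_bound]).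

Forward error: since |f_i - f_j| is at most the largest divided difference times
|x_i - x_j|, the second term is at most 2 W times that divided difference.  The
error of each block is therefore bounded by a multiple of W, and in the quotient
by the sum of the W these bounds average, with a constant independent of n
([forward_bound]). *)

(** * Products of rounding factors *)

(** The range from (1 - e)^r to (1 - e)^-r, the upper bound being stated without
inverse. *)
Definition rounding (R : realType) (e : R) (r : nat) (z : R) : Prop :=
  (1 - e) ^+ r <= z /\ (1 - e) ^+ r * z <= 1.

Section Roundings.
Variables (R : realType) (e : R).
Hypotheses (e_gt0 : 0 < e) (e_lt1 : e < 1).

Let u_gt0 r : 0 < (1 - e) ^+ r.
Proof. by rewrite exprn_gt0 ?subr_gt0. Qed.

Let u_le1 r : (1 - e) ^+ r <= 1.
Proof. by rewrite exprn_ile1 // ?subr_ge0 ?gerBl ltW. Qed.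

Lemma rounding_gt0 r z : rounding e r z -> 0 < z.
Proof. by case=> h _; exact: lt_le_trans (u_gt0 r) h. Qed.

Lemma rounding1 r : rounding e r 1.
Proof. by split; rewrite ?mulr1. Qed.

Lemma rounding_Erho z : Erho e 1 z -> rounding e 1 z.
Proof.
have u0 := u_gt0 1; rewrite expr1 in u0.
rewrite /Erho /= powR_inv1 ?powRr1 ?(ltW u0) // => /andP[h1 h2].
by split; rewrite expr1 // mulrC -ler_pdivlMr // div1r.
Qed.

Lemma roundingM r s z w :
  rounding e r z -> rounding e s w -> rounding e (r + s) (z * w).
Proof.
move=> hz hw; have z0 := rounding_gt0 hz; have w0 := rounding_gt0 hw.
case: hz hw => [z1 z2] [w1 w2]; rewrite /rounding exprD; split.
  by rewrite ler_pM // ltW.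
by rewrite mulrACA mulr_ile1 // mulr_ge0 // ltW.
Qed.

Lemma roundingV r z : rounding e r z -> rounding e r z^-1.
Proof.
move=> hz; have z0 := rounding_gt0 hz; case: hz => [z1 z2]; split.
  by rewrite -[leRHS]mul1r ler_pdivlMr.
by rewrite ler_pdivrMr ?mul1r.
Qed.

Lemma rounding_leq r s z : (r <= s)%N -> rounding e r z -> rounding e s z.
Proof.
move=> rs hz; have z0 := rounding_gt0 hz; case: hz => [z1 z2].
have h : (1 - e) ^+ s <= (1 - e) ^+ r.
  by rewrite -(subnKC rs) exprD ler_piMr // ltW.
by split; [exact: le_trans z1 | apply: le_trans z2; rewrite ler_pM2r].
Qed.

Lemma bernoulli r : 1 - r%:R * e <= (1 - e) ^+ r.
Proof.
elim: r => [|r IH]; first by rewrite mul0r subr0.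
rewrite exprS; apply: (le_trans (y := (1 - e) * (1 - r%:R * e))).
  have : 0 <= r%:R * e * e by rewrite !mulr_ge0 // ltW.
  by rewrite -natr1; lra.
by rewrite ler_pM2l // subr_gt0.
Qed.

Lemma rounding_linear r z :
  rounding e r z -> 1 - r%:R * e <= z /\ (1 - r%:R * e) * z <= 1.
Proof.
move=> hz; have z0 := rounding_gt0 hz; case: hz => [z1 z2].
split; first exact: le_trans (bernoulli r) z1.
by apply: le_trans z2; rewrite ler_pM2r // bernoulli.
Qed.

Lemma rounding_dist r z : rounding e r z -> r%:R * e <= 99 / 10000 ->
  `|z - 1| <= 101 / 100 * (r%:R * e).
Proof.
move=> hz; have z0 := rounding_gt0 hz.
have : 0 <= r%:R * e by rewrite mulr_ge0 // ltW.
have [] := rounding_linear hz; move: (r%:R * e) => q h1 h2 q0 hq.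
rewrite ler_norml; apply/andP; split; first by lra.
by nra.
Qed.

(** Rounding factors attached to terms of the same sign average out. *)
Lemma rounding_mean r x y z w : 0 <= x -> 0 <= y ->
  rounding e r z -> rounding e r w ->
  exists2 v, rounding e r v & x * z + y * w = (x + y) * v.
Proof.
move=> x0 y0 [z1 z2] [w1 w2].
have [xy|xy] := leP (x + y) 0.
  have -> : x = 0 by lra.
  have -> : y = 0 by lra.
  by exists 1; [exact: rounding1 | lra].
exists ((x * z + y * w) / (x + y)); last by rewrite [RHS]mulrC divfK // gt_eqF.
split; first by rewrite ler_pdivlMr //; nra.
by rewrite mulrA ler_pdivrMr // mul1r; nra.
Qed.

End Roundings.

(** * Expressions evaluated with a small relative error *)

Definition approx (R : realType) (e : R) (r : nat) (xhat x : R) : Prop :=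
  exists2 z, rounding e r z & xhat = x * z.

(** The exact and the computed evaluation of an expression go together: a
rounding never turns a nonzero value into zero, so that a divisor which is
nonzero in exact arithmetic stays so when computed. *)
Record evaluates (R : realType) (M : fp_arith R) (n : nat) (t : R)
    (x f : 'I_n.+1 -> R) (a : expr n) (v : R) (r : nat) : Prop := Evaluates {
  ev_exact_defined : defined (exact_arith R) t x f a;
  ev_exact : eval (exact_arith R) t x f a = v;
  ev_defined : defined (computed_arith M) t x f a;
  ev_float : float M (eval (computed_arith M) t x f a);
  ev_approx : approx (eps M) r (eval (computed_arith M) t x f a) v
}.

Section Evaluation.
Variables (R : realType) (M : fp_arith R) (n : nat) (t : R).
Variables (x f : 'I_n.+1 -> R).
Hypothesis eps_lt1 : eps M < 1.
Let e_gt0 := eps_gt0 M.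
Local Notation evaluates := (evaluates M t x f).

Lemma approx_eq0 e r y z : e < 1 ->
  @approx R e r y z -> (y == 0) = (z == 0).
Proof.
move=> e1 [w hw ->].
by rewrite mulf_eq0 (gt_eqF (rounding_gt0 e1 hw)) orbF.
Qed.

Lemma approx_fl o y z : float M y -> float M z -> (o = Div -> z <> 0) ->
  approx (eps M) 1 (fl M o y z) (exact_op o y z).
Proof.
move=> fy fz oz; have [w hw ->] := fl_error fy fz oz.
by exists w; first exact: rounding_Erho.
Qed.

Lemma approx_trans r s y z w :
  approx (eps M) r y z -> approx (eps M) s z w -> approx (eps M) (s + r) y w.
Proof.
move=> [a ha ->] [b hb ->]; exists (b * a); first exact: roundingM.
by rewrite mulrA.
Qed.

Lemma evaluates_input a v :
  defined (exact_arith R) t x f a -> defined (computed_arith M) t x f a ->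
  eval (exact_arith R) t x f a = v ->
  eval (computed_arith M) t x f a = v -> float M v -> evaluates a v 0.
Proof.
move=> ? ? ? h fv; split=> //; rewrite h //.
by exists 1; [exact: rounding1 | rewrite mulr1].
Qed.

Lemma evaluates_pow2 (z : int) : evaluates (EPow2 z) (2 ^ z) 0.
Proof. by apply: evaluates_input => //; exact: float_pow2. Qed.

Lemma evaluates_leq a v r s : (r <= s)%N -> evaluates a v r -> evaluates a v s.
Proof.
move=> rs [? ? ? ? [z hz hv]]; split=> //; exists z => //.
exact: rounding_leq hz.
Qed.

Lemma evaluates_op o a b u v r s q : evaluates a u r -> evaluates b v s ->
    (o = Div -> v <> 0) ->
  (forall uh vh, approx (eps M) r uh u -> approx (eps M) s vh v ->
     approx (eps M) q (exact_op o uh vh) (exact_op o u v)) ->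
  evaluates (EOp o a b) (exact_op o u v) q.+1.
Proof.
move=> [da ea ha fa aa] [db eb hb fb ab] ov h.
have ov' : o = Div -> eval (computed_arith M) t x f b <> 0.
  by move=> /ov /eqP v0; apply/eqP; rewrite (approx_eq0 _ ab).
split => /=.
- by split=> //; rewrite eb.
- by rewrite ea eb.
- by split.
- exact: float_fl.
- by rewrite -addn1; apply: approx_trans (h _ _ aa ab); exact: approx_fl.
Qed.

Lemma evaluates_mul a b u v r s : evaluates a u r -> evaluates b v s ->
  evaluates (EOp Mul a b) (u * v) (r + s).+1.
Proof.
move=> ha hb; apply: (evaluates_op ha hb) => //= _ _ [z hz ->] [w hw ->].
by exists (z * w); [exact: roundingM | rewrite mulrACA].
Qed.

Lemma evaluates_div a b u v r s : evaluates a u r -> evaluates b v s -> v != 0 ->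
  evaluates (EOp Div a b) (u / v) (r + s).+1.
Proof.
move=> ha hb v0; apply: (evaluates_op ha hb) => /=; first by move=> _; apply/eqP.
move=> _ _ [z hz ->] [w hw ->].
exists (z / w); first by apply: roundingM => //; exact: roundingV.
by rewrite invfM mulrACA.
Qed.

Lemma evaluates_add a b u v r : evaluates a u r -> evaluates b v r ->
  0 <= u -> 0 <= v -> evaluates (EOp Add a b) (u + v) r.+1.
Proof.
move=> ha hb u0 v0; apply: (evaluates_op ha hb) => //= _ _ [z hz ->] [w hw ->].
by have [y hy ->] := rounding_mean e_gt0 eps_lt1 u0 v0 hz hw; exists y.
Qed.

(** In a sum of terms of arbitrary signs only the relative error of each term
survives, the rounding of the sum being charged to both. *)
Lemma computed_add a b u v r s (e := EOp Add a b) :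
  evaluates a u r -> evaluates b v s ->
  [/\ defined (exact_arith R) t x f e, eval (exact_arith R) t x f e = u + v,
      defined (computed_arith M) t x f e,
      float M (eval (computed_arith M) t x f e) &
      exists z w, [/\ rounding (eps M) r.+1 z, rounding (eps M) s.+1 w &
        eval (computed_arith M) t x f e = u * z + v * w]].
Proof.
move=> [da ea ha fa [z hz az]] [db eb hb fb [w hw bw]].
have h : Add = Div -> eval (computed_arith M) t x f b <> 0 by [].
split=> //=; [by rewrite ea eb | exact: float_fl |].
have [y hy ->] := approx_fl fa fb h.
exists (z * y), (w * y); rewrite -(addn1 r) -(addn1 s) /= az bw.
by split; [exact: roundingM | exact: roundingM | ring].
Qed.

(** Cancellation is harmless when the operands carry no error. *)
Lemma evaluates_sub a b u v : evaluates a u 0 -> evaluates b v 0 ->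
  evaluates (EOp Defs.Sub a b) (u - v) 1.
Proof.
have r0 z : rounding (eps M) 0 z -> z = 1.
  by case; rewrite expr0 mul1r => h1 h2; apply/eqP; rewrite eq_le h1 h2.
move=> ha hb; apply: (evaluates_op ha hb) => //= _ _ [z /r0 -> ->] [w /r0 -> ->].
by exists 1; [exact: rounding1 | rewrite !mulr1].
Qed.

Lemma evaluates_mul_pow2 a u r (z : int) : evaluates a u r ->
  evaluates (EOp Mul a (EPow2 z)) (u * 2 ^ z) r.
Proof.
move=> [da ea ha fa [w hw aw]]; split=> //=; first by rewrite ea.
- by apply: float_fl => //; exact: float_pow2.
- by rewrite fl_mul_pow2 // aw; exists w => //; rewrite mulrAC.
Qed.

End Evaluation.

(** * Grouping the nodes *)

(** Block p holds the nodes numbered 2p and 2p + 1 after a shift of the numbering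
by one when k is even; the shift puts x_k last in its block and x_{k+1} first in
the next one.  [Pair i j] lists the node nearer to t first, and [Blank] pads the
list when n and k are odd, in which case m blocks suffice. *)
Inductive block (n : nat) := Blank | Lone of 'I_n.+1 | Pair of 'I_n.+1 & 'I_n.+1.
Arguments Blank {n}.

Definition block_index (k i : nat) : nat := (i + ~~ odd k)./2.

Definition block_of (n k p : nat) : block n :=
  let a := (p.*2 - ~~ odd k)%N in
  if (p == 0%N) && ~~ odd k then Lone ord0
  else if (n < a)%N then Blank
  else if a == n then Lone ord_max
  else if (a < k)%N then Pair (inord a.+1) (inord a)
  else Pair (inord a) (inord a.+1).

Definition block_sum (R : realType) (n : nat) (g : block n) (F : 'I_n.+1 -> R) : R :=
  match g with
  | Blank => 0
  | Lone i => F i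
  | Pair i j => F i + F j
  end.

Definition endpoint (n : nat) (i : 'I_n.+1) : bool := (i == 0%N :> nat) || (i == n :> nat).

(** The nodes whose terms become positive when the denominator is multiplied by
(-1)^k. *)
Definition leads (k i : nat) : bool := odd (i + k) == (k < i)%N.

Definition alternating (n k : nat) (g : block n) : Prop :=
  match g with
  | Blank => True
  | Lone i => leads k i /\ endpoint i
  | Pair i j => [/\ leads k i, ~~ leads k j, ~~ endpoint i &
      (j.+1 = i :> nat /\ (i <= k)%N) \/ ((k < i)%N /\ j = i.+1 :> nat)]
  end.

Lemma block_sumE (R : realType) (n k p : nat) (F : 'I_n.+1 -> R) : (k < n)%N ->
  \sum_(i < n.+1 | block_index k i == p) F i = block_sum (block_of n k p) F.
Proof.
move=> kn; rewrite /block_of; case: ifP => [h|p0] /=.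
  by rewrite (big_pred1 ord0) // => i; rewrite /block_index /= -val_eqE /=; lia.
case: ltnP => [na|an] /=.
  by apply: big_pred0 => i; rewrite /block_index; have := ltn_ord i; lia.
case: eqP => [an'|an'] /=.
  rewrite (big_pred1 ord_max) // => i.
  by rewrite /block_index /= -val_eqE /=; have := ltn_ord i; lia.
have ha : (p.*2 - ~~ odd k < n.+1)%N by lia.
have hb : ((p.*2 - ~~ odd k).+1 < n.+1)%N by lia.
transitivity (F (inord (p.*2 - ~~ odd k).+1) + F (inord (p.*2 - ~~ odd k))).
  2: by case: ifP => _ //=; rewrite addrC.
rewrite (bigD1 (inord (p.*2 - ~~ odd k).+1)) /=; last first.
  by rewrite /block_index inordK //; lia.
congr (_ + _); apply: big_pred1 => i.
by rewrite /block_index /= -!val_eqE /= !inordK //; lia.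
Qed.

Lemma block_of_alternating (n k p : nat) : (k < n)%N ->
  alternating k (block_of n k p).
Proof.
move=> kn; rewrite /block_of; case: ifP => [h|p0] /=.
  by split=> //; rewrite /leads; lia.
case: ltnP => [//|an]; case: eqP => [an'|an'] /=.
  by split; rewrite /leads /endpoint /=; lia.
have ha : (p.*2 - ~~ odd k < n.+1)%N by lia.
have hb : ((p.*2 - ~~ odd k).+1 < n.+1)%N by lia.
case: ltnP => h /=; split; rewrite /leads /endpoint ?inordK //; lia.
Qed.

Lemma block_of_index (n k : nat) : (k < n)%N ->
  block_of n k (block_index k k) <> Blank.
Proof.
move=> kn; rewrite /block_of /block_index; case: ifP => // _.
by case: ifP; [lia | case: ifP => // _ _; case: ifP].
Qed.

(** After the shift the last node has number at most n + 1, which must be less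
than 2 (m + 1). *)
Lemma sum_blocks (R : realType) (n k m : nat) (F : 'I_n.+1 -> R) :
  (k < n)%N -> (n < (m.+1).*2 - 1)%N ->
  \sum_(i < n.+1) F i = \sum_(p < m.+1) block_sum (block_of n k p) F.
Proof.
move=> kn nm.
rewrite (partition_big (fun i : 'I_n.+1 => inord (block_index k i) : 'I_m.+1) xpredT) //=.
apply: eq_bigr => p _; rewrite -block_sumE //; apply: eq_bigl => i.
rewrite -val_eqE /= inordK //.
by rewrite /block_index; have := ltn_ord i; lia.
Qed.

Lemma weightE (R : realType) (n : nat) (i : 'I_n.+1) :
  weight R i = (-1) ^+ i * (if endpoint i then 1 / 2 else 1).
Proof.
rewrite /weight /endpoint; case: eqP => [->|_] /=; first by rewrite expr0 !mul1r.
by case: (i =P n :> nat) => [->|_]; rewrite /= ?div1r ?mulr1.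
Qed.

Lemma between_nodes (R : realType) (n : nat) (x : 'I_n.+1 -> R) (t : R) :
  x ord0 <= t <= x ord_max -> (forall i, t <> x i) ->
  exists k : 'I_n, x (inord k) < t < x (inord k.+1).
Proof.
move=> /andP[x0 xn] tx.
have h0 : x (inord 0) < t.
  rewrite lt_neqAle (_ : inord 0 = ord0) ?x0 ?andbT; last by apply: val_inj; rewrite /= inordK.
  by apply/eqP => /esym /tx.
have hn : t < x (inord n).
  rewrite lt_neqAle (_ : inord n = ord_max) ?xn ?andbT; last by apply: val_inj; rewrite /= inordK.
  by apply/eqP => /tx.
have : forall j, (j <= n)%N -> t < x (inord j) ->
    exists k : 'I_n, x (inord k) < t < x (inord k.+1).
  elim=> [|j IH] jn tj; first by move: (lt_trans h0 tj); rewrite ltxx.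
  have [/(IH (ltnW jn))//|] := ltP t (x (inord j)).
  rewrite le_eqVlt => /orP[/eqP/esym /tx//|xj].
  by exists (Ordinal jn); rewrite xj tj.
by move=> /(_ n (leqnn n) hn).
Qed.

(** * The expressions of a block *)

Definition dist_expr (n k : nat) (i : 'I_n.+1) : expr n :=
  if (i <= k)%N then EOp Defs.Sub EPoint (ENode i)
  else EOp Defs.Sub (ENode i) EPoint.

Definition gap_expr (n k : nat) (i j : 'I_n.+1) : expr n :=
  if (i <= k)%N then EOp Defs.Sub (ENode i) (ENode j)
  else EOp Defs.Sub (ENode j) (ENode i).

(** For a far endpoint, d_j - d_i / 2 = (d_j + |x_i - x_j|) / 2 avoids the
cancellation of the difference. *)
Definition block_weight (n k : nat) (g : block n) : expr n :=
  match g with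
  | Blank => EOp Defs.Sub (EPow2 0) (EPow2 0)
  | Lone i => EOp Div (EPow2 (-1)) (dist_expr k i)
  | Pair i j =>
    if endpoint j then
      EOp Div (EOp Add (dist_expr k j) (gap_expr k i j))
              (EOp Mul (EOp Mul (dist_expr k i) (dist_expr k j)) (EPow2 1))
    else EOp Div (gap_expr k i j) (EOp Mul (dist_expr k i) (dist_expr k j))
  end.

Definition block_value (n k : nat) (g : block n) : expr n :=
  match g with
  | Blank => EOp Defs.Sub (EPow2 0) (EPow2 0)
  | Lone i => EOp Mul (EValue i) (block_weight k g)
  | Pair i j =>
    EOp Add (EOp Mul (EValue i) (block_weight k g))
      (EOp Div (EOp Defs.Sub (EValue i) (EValue j))
         (if endpoint j then EOp Mul (dist_expr k j) (EPow2 1)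
          else dist_expr k j))
  end.

Definition coef (R : realType) (n k : nat) (t : R) (x : 'I_n.+1 -> R)
    (i : 'I_n.+1) : R :=
  (-1) ^+ k * (weight R i / (t - x i)).

Definition end_factor (R : realType) (n : nat) (j : 'I_n.+1) : R :=
  if endpoint j then 1 / 2 else 1.

Lemma end_factor_gt0 (R : realType) (n : nat) (j : 'I_n.+1) : 0 < end_factor R j.
Proof. by rewrite /end_factor; case: ifP => _ //; rewrite divr_gt0. Qed.

Lemma ler_sup_norm (R : realType) (d : nat) (v : 'I_d -> R) i : `|v i| <= sup_norm v.
Proof. exact: (le_bigmax 0 (fun i => `|v i|)). Qed.

Lemma sup_norm_ge0 (R : realType) (d : nat) (v : 'I_d -> R) : 0 <= sup_norm v.
Proof. exact: bigmax_ge_id. Qed.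

Lemma divided_diff_bound (R : realType) (n : nat) (x f : 'I_n.+1 -> R)
    (i j : 'I_n.+1) : j = i.+1 :> nat -> x i < x j ->
  `|f i - f j| <= sup_norm (divided_diff x f) * (x j - x i).
Proof.
move=> ji xij; have lt_in : (i < n)%N by rewrite -ltnS -ji ltn_ord.
have := ler_sup_norm (divided_diff x f) (Ordinal lt_in).
rewrite /divided_diff /= -ji !inord_val normrM normfV distrC.
by rewrite [`|x j - x i|]gtr0_norm ?subr_gt0 // ler_pdivrMr ?subr_gt0.
Qed.

Section Blocks.
Variables (R : realType) (n k : nat) (t : R) (x f : 'I_n.+1 -> R).
Hypothesis x_left : forall i : 'I_n.+1, (i <= k)%N -> x i < t.
Hypothesis x_right : forall i : 'I_n.+1, (k < i)%N -> t < x i.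
Local Notation s := (coef k t x).
Local Notation dist i := `|t - x i|.

Let dist_gt0 i : 0 < dist i.
Proof.
rewrite normr_gt0 subr_eq0.
by case: (leqP i k) => [/x_left|/x_right] h; rewrite ?(gt_eqF h) ?(lt_eqF h).
Qed.

Lemma coefE i : s i = (if leads k i then 1 else -1) * end_factor R i / dist i.
Proof.
have ->: s i = (-1) ^+ (i + k) * end_factor R i / (t - x i).
  by rewrite /coef weightE -/(end_factor R i) exprD; ring.
rewrite -signr_odd /leads.
case: (leqP i k) => [/x_left|/x_right] h.
  rewrite gtr0_norm ?subr_gt0 //.
  by case: (odd _); rewrite /= ?expr1 ?expr0.
rewrite ltr0_norm ?subr_lt0 // invrN.
by case: (odd _); rewrite /= ?expr1 ?expr0; ring.
Qed.

Lemma gapE i j : alternating k (Pair i j) ->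
  dist j - dist i = if (i <= k)%N then x i - x j else x j - x i.
Proof.
move=> [_ _ _ [[ji ik]|[ki ji]]].
  rewrite ik; by rewrite !gtr0_norm ?subr_gt0 ?x_left //; [ring | lia].
rewrite leqNgt ki; by rewrite !ltr0_norm ?subr_lt0 ?x_right //; [ring | lia].
Qed.

Hypothesis x_incr : forall i j : 'I_n.+1, (i < j)%N -> x i < x j.

Lemma gap_gt0 i j : alternating k (Pair i j) -> 0 < dist j - dist i.
Proof.
move=> ok; rewrite gapE //; case: ok => _ _ _ [[ji ik]|[ki ji]].
  by rewrite ik subr_gt0 x_incr // -ji.
by rewrite leqNgt ki subr_gt0 x_incr // ji.
Qed.

Lemma block_sum_coef_pair i j (h : 'I_n.+1 -> R) : alternating k (Pair i j) ->
  block_sum (Pair i j) (fun l => s l * h l) =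
  h i / dist i - h j * (end_factor R j / dist j).
Proof.
move=> [li lj ei _] /=; rewrite !coefE li (negbTE lj).
rewrite {1}/end_factor (negbTE ei); ring.
Qed.

Lemma block_sum_coef_lone i (h : 'I_n.+1 -> R) : alternating k (Lone i) ->
  block_sum (Lone i) (fun l => s l * h l) = h i * (2^-1 / dist i).
Proof.
move=> [li ei] /=; rewrite coefE li /end_factor ei; ring.
Qed.

Lemma block_sum1 g : block_sum g s = block_sum g (fun l => s l * 1).
Proof. by case: g => * //=; rewrite !mulr1. Qed.

Lemma pair_weightE i j : alternating k (Pair i j) ->
  block_sum (Pair i j) s =
  (dist j - end_factor R j * dist i) / (dist i * dist j).
Proof.
move=> ok; rewrite block_sum1 block_sum_coef_pair //.
have i0 := dist_gt0 i; have j0 := dist_gt0 j; field.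
by rewrite !gt_eqF.
Qed.

Lemma block_weight_gt0 g : alternating k g -> g <> Blank -> 0 < block_sum g s.
Proof.
case: g => [|i|i j] ok // _.
  by rewrite block_sum1 block_sum_coef_lone // mul1r divr_gt0 // invr_gt0.
rewrite pair_weightE // divr_gt0 ?mulr_gt0 //.
have := gap_gt0 ok; have := dist_gt0 i; rewrite /end_factor.
by case: ifP => _; lra.
Qed.

Lemma block_weight_ge0 g : alternating k g -> 0 <= block_sum g s.
Proof.
by case: g => [|i|i j] ok //; apply/ltW/block_weight_gt0.
Qed.


Variable M : fp_arith R.
Hypotheses (eps_small : 22 * eps M < 1 / 100) (t_float : float M t).
Hypothesis x_float : forall i, float M (x i).
Local Notation evaluates := (evaluates M t x f).

Let e_gt0 : 0 < eps M.
Proof. exact: eps_gt0. Qed.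

Let e_lt1 : eps M < 1.
Proof. by have := e_gt0; move: eps_small; lra. Qed.

Lemma evaluates_dist i : evaluates (dist_expr k i) (dist i) 1.
Proof.
have ht : evaluates EPoint t 0 by exact: evaluates_input.
have hx : evaluates (ENode i) (x i) 0 by exact: evaluates_input.
rewrite /dist_expr; case: (leqP i k) => [/x_left|/x_right] h.
  by rewrite gtr0_norm ?subr_gt0 //; exact: evaluates_sub.
by rewrite ltr0_norm ?subr_lt0 // opprB; exact: evaluates_sub.
Qed.

Lemma evaluates_gap i j : alternating k (Pair i j) ->
  evaluates (gap_expr k i j) (dist j - dist i) 1.
Proof.
have hx l : evaluates (ENode l) (x l) 0 by exact: evaluates_input.
by move=> /gapE ->; rewrite /gap_expr; case: ifP => _; exact: evaluates_sub.
Qed.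

(** The six roundings occur at a far endpoint: two in its numerator, made of
positive terms, three in its denominator, one in the division. *)
Lemma evaluates_block_weight g : alternating k g ->
  evaluates (block_weight k g) (block_sum g s) 6.
Proof.
have hd := evaluates_dist; have d0 i : dist i != 0 by rewrite gt_eqF.
case: g => [|i|i j] ok.
- apply: (evaluates_leq e_lt1 (r := 1)) => //; rewrite /= -(subrr (2 ^ 0 : R)).
  by apply: evaluates_sub => //; exact: evaluates_pow2.
- rewrite block_sum1 block_sum_coef_lone // mul1r.
  apply: (evaluates_leq e_lt1 (r := 2)) => //.
  rewrite -(exprN1 2).
  exact: (evaluates_div e_lt1 (evaluates_pow2 t x f e_lt1 _) (hd i) (d0 i)).
rewrite pair_weightE //; have gap0 := gap_gt0 ok.
have hg := evaluates_gap ok.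
have hm := evaluates_mul e_lt1 (hd i) (hd j).
rewrite /= /end_factor; case: ifP => ej; last first.
  rewrite mul1r; apply: (evaluates_leq e_lt1 (r := 5)) => //.
  by apply: (evaluates_div e_lt1 hg hm); rewrite mulf_neq0.
have -> : (dist j - 1 / 2 * dist i) / (dist i * dist j) =
          (dist j + (dist j - dist i)) / (dist i * dist j * 2 ^ 1).
  rewrite expr1z; move: (d0 i) (d0 j) => di dj; field.
  by rewrite di dj.
apply: (evaluates_div e_lt1 (r := 2) (s := 3)).
- exact: (evaluates_add e_lt1 (hd j) hg (ltW (dist_gt0 j)) (ltW gap0)).
- exact: evaluates_mul_pow2.
- by rewrite expr1z !mulf_neq0 ?pnatr_eq0.
Qed.

Hypothesis f_float : forall i, float M (f i).
Hypothesis x_le1 : forall i, `|x i| <= 1.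
Hypothesis t_le1 : `|t| <= 1.

Let dist_le2 i : dist i <= 2.
Proof. apply: le_trans (ler_normB _ _) _; by have := x_le1 i; move: t_le1; lra. Qed.

Local Notation F := (sup_norm f).
Local Notation G := (sup_norm (divided_diff x f)).
Local Notation neighbour i :=
  (Num.max `|prev_value f i| `|next_value f i|).

Lemma pair_diff_bound i j : alternating k (Pair i j) ->
  `|f i - f j| <= G * (dist j - dist i).
Proof.
move=> ok; rewrite gapE //; case: ok => _ _ _ [[ji ik]|[ki ji]].
  by rewrite ik distrC; apply: divided_diff_bound => //; apply: x_incr; rewrite -ji.
by rewrite leqNgt ki; apply: divided_diff_bound => //; apply: x_incr; rewrite ji.
Qed.

Lemma far_neighbour i j : alternating k (Pair i j) -> `|f i| <= neighbour j.
Proof.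
move=> [_ _ _ [[ji ik]|[ki ji]]]; rewrite le_max; apply/orP.
  right; rewrite /next_value ji inord_val ifF //.
  by apply/eqP; have := ltn_ord i; lia.
by left; rewrite /prev_value ji /= inord_val.
Qed.

(** Since |f_i - f_j| <= G |x_i - x_j| and d_i <= 2, this reduces to
c |x_i - x_j| d_i <= 2 (d_j - c d_i). *)
Lemma pair_rest_bound i j : alternating k (Pair i j) ->
  `|(f i - f j) * (end_factor R j / dist j)| <= block_sum (Pair i j) s * (2 * G).
Proof.
move=> ok; rewrite pair_weightE //.
have i0 := dist_gt0 i; have j0 := dist_gt0 j.
have gap0 := gap_gt0 ok; have G0 := sup_norm_ge0 (divided_diff x f).
have c0 := end_factor_gt0 R j; have i2 := dist_le2 i.
rewrite normrM [`|end_factor R j / _|]gtr0_norm ?divr_gt0 //.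
apply: (le_trans (ler_wpM2r (ltW (divr_gt0 c0 j0)) (pair_diff_bound ok))).
have -> : (dist j - end_factor R j * dist i) / (dist i * dist j) * (2 * G) =
  G * (2 * (dist j - end_factor R j * dist i) / dist i) / dist j.
  by field; rewrite !gt_eqF.
rewrite -!mulrA ler_wpM2l // !mulrA ler_pM2r ?invr_gt0 // ler_pdivlMr //.
by move: i2 gap0 i0; rewrite /end_factor; case: ifP => _; nra.
Qed.

(** What the error analysis needs from the computed numerator of a block: the
size of the exact one, the forward error, and the perturbed values of f that
explain it, all relative to the denominator of the block. *)
Definition value_spec (g : block n) (Vh : R) : Prop :=
  [/\ `|block_sum g (fun i => s i * f i)| <= block_sum g s * (F + 2 * G),
   `|Vh - block_sum g (fun i => s i * f i)| <=
     block_sum g s * (9 * F + 9 * G) * eps M &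
   exists2 ft : 'I_n.+1 -> R, Vh = block_sum g (fun i => s i * ft i) &
     forall i, exists2 a, rounding (eps M) 8 a &
       `|ft i - f i * a| <= 13 * eps M * neighbour i].

Lemma rounding_eps r z : (r <= 20)%N -> rounding (eps M) r z ->
  `|z - 1| <= 101 / 100 * (r%:R * eps M).
Proof.
move=> r20 hz; apply: rounding_dist => //.
have : r%:R <= 20 :> R by rewrite ler_nat.
by move: eps_small e_gt0; nra.
Qed.

Lemma value_spec_scaled g z : alternating k g -> rounding (eps M) 8 z ->
  `|block_sum g (fun i => s i * f i)| <= block_sum g s * F ->
  value_spec g (block_sum g (fun i => s i * f i) * z).
Proof.
move=> ok hz; set V := block_sum g _; set W := block_sum g s => VW.
have W0 : 0 <= W by exact: block_weight_ge0.
have F0 := sup_norm_ge0 f; have G0 := sup_norm_ge0 (divided_diff x f).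
have WF0 : 0 <= W * F by exact: mulr_ge0.
have WG0 : 0 <= W * G by exact: mulr_ge0.
split; rewrite -/V -/W.
- by lra.
- have -> : V * z - V = V * (z - 1) by ring.
  rewrite normrM; apply: (le_trans (ler_pM _ _ VW (rounding_eps _ hz))) => //.
  have -> : W * (9 * F + 9 * G) = 9 * (W * F) + 9 * (W * G) by ring.
  by move: e_gt0; nra.
- exists (fun i => f i * z).
    by rewrite /V; case: (g) => * /=; ring.
  move=> i; exists z => //; rewrite subrr normr0 mulr_ge0 ?le_max ?normr_ge0 //.
  by rewrite mulr_ge0 // ltW.
Qed.

(** The roundings are counted as follows: [a] collects six for the weight, one
for its product with f_i and one for the final addition; [b] three for the
second term and the same addition. *)
Lemma value_spec_pair i j a b : alternating k (Pair i j) ->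
  rounding (eps M) 8 a -> rounding (eps M) 4 b ->
  value_spec (Pair i j) (f i * block_sum (Pair i j) s * a +
                         (f i - f j) * (end_factor R j / dist j) * b).
Proof.
move=> ok ha hb; have rest := pair_rest_bound ok.
have WE := pair_weightE ok; have VE := block_sum_coef_pair f ok.
have W0 := block_weight_ge0 ok; have fF := ler_sup_norm f i.
have a1 : `|a - 1| <= _ := rounding_eps (isT : 8 <= 20)%N ha.
have b1 : `|b - 1| <= _ := rounding_eps (isT : 4 <= 20)%N hb.
have V2 : block_sum (Pair i j) (fun l => s l * f l) =
    f i * block_sum (Pair i j) s + (f i - f j) * (end_factor R j / dist j).
  rewrite VE WE; have i0 := dist_gt0 i; have j0 := dist_gt0 j; field.
  by rewrite !gt_eqF.
have fW : `|f i * block_sum (Pair i j) s| <= block_sum (Pair i j) s * F.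
  by rewrite normrM (ger0_norm W0) mulrC ler_wpM2l.
have F0 := sup_norm_ge0 f; have G0 := sup_norm_ge0 (divided_diff x f).
split.
- rewrite V2; apply: (le_trans (ler_normD _ _)).
  by rewrite [leRHS]mulrDr; exact: lerD.
- rewrite V2; move: (block_sum _ s) W0 rest fW => W W0 rest fW.
  move: (f i * W) (_ * (_ / _)) rest fW => p r rest fW.
  have -> : p * a + r * b - (p + r) = p * (a - 1) + r * (b - 1) by ring.
  apply: (le_trans (ler_normD _ _)); rewrite !normrM.
  have h1 := ler_pM (normr_ge0 p) (normr_ge0 _) fW a1.
  have h2 := ler_pM (normr_ge0 r) (normr_ge0 _) rest b1.
  apply: (le_trans (lerD h1 h2)).
  have WF0 : 0 <= W * F * eps M by rewrite !mulr_ge0 // ltW.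
  have WG0 : 0 <= W * G * eps M by rewrite !mulr_ge0 // ltW.
  by lra.
- have ij : i != j.
    by apply/eqP => eij; case: ok => li; rewrite -eij li.
  (* f_i W a + (f_i - f_j) (c / d_j) b, expanded in 1 / d_i and c / d_j *)
  exists (fun l => if l == j then f j * b + f i * (a - b) else f l * a).
    rewrite block_sum_coef_pair // eqxx (negbTE ij) WE.
    have i0 := dist_gt0 i; have j0 := dist_gt0 j; field.
    by rewrite !gt_eqF.
  have N0 l : 0 <= neighbour l by rewrite le_max normr_ge0.
  move=> l; case: eqP => [->|_]; last first.
    by exists a => //; rewrite subrr normr0 mulr_ge0 // mulr_ge0 // ltW.
  exists b; first exact: rounding_leq hb.
  rewrite addrAC subrr add0r normrM mulrC.
  apply: ler_pM => //; last exact: far_neighbour.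
  have -> : a - b = (a - 1) - (b - 1) by ring.
  apply: (le_trans (ler_normB _ _)).
  by move: e_gt0; lra.
Qed.

Lemma block_valueP g : alternating k g ->
  let v := eval (computed_arith M) t x f (block_value k g) in
  [/\ defined (exact_arith R) t x f (block_value k g),
      eval (exact_arith R) t x f (block_value k g) =
        block_sum g (fun i => s i * f i),
      defined (computed_arith M) t x f (block_value k g),
      float M v & value_spec g v].
Proof.
move=> ok v; have hw := evaluates_block_weight ok.
have hf i : evaluates (EValue i) (f i) 0 by exact: evaluates_input.
have scaled V r : (r <= 8)%N -> evaluates (block_value k g) V r ->
    V = block_sum g (fun i => s i * f i) -> `|V| <= block_sum g s * F ->
    [/\ defined (exact_arith R) t x f (block_value k g),
        eval (exact_arith R) t x f (block_value k g) =
          block_sum g (fun i => s i * f i),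
        defined (computed_arith M) t x f (block_value k g),
        float M v & value_spec g v].
  move=> r8 [? -> ? ? [z hz vE]] VE VF; split=> //.
  rewrite /v vE VE; apply: value_spec_scaled => //; last by rewrite -VE.
  exact: rounding_leq hz.
case: g @v ok hw scaled => [|i|i j] v ok hw scaled.
- apply: (scaled 0 1%N) => //=; last by rewrite normr0 mul0r.
  by rewrite -(subrr (2 ^ 0 : R)); apply: evaluates_sub => //; exact: evaluates_pow2.
- apply: (scaled (f i * block_sum (Lone i) s) 7%N) => //.
  + exact: (evaluates_mul e_lt1 (hf i) hw).
  + by rewrite /= mulrC.
  + by rewrite normrM (ger0_norm (block_weight_ge0 ok)) mulrC ler_wpM2l
      ?ler_sup_norm ?block_weight_ge0.
have h1 := evaluates_mul e_lt1 (hf i) hw.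
have h2 : evaluates (EOp Div (EOp Defs.Sub (EValue i) (EValue j))
    (if endpoint j then EOp Mul (dist_expr k j) (EPow2 1) else dist_expr k j))
    ((f i - f j) * (end_factor R j / dist j)) 3.
  have j0 := dist_gt0 j; have hs := evaluates_sub e_lt1 (hf i) (hf j).
  have hd := evaluates_dist j.
  rewrite /end_factor; case: ifP => _; last first.
    by rewrite mul1r; apply: (evaluates_div e_lt1 hs hd); rewrite gt_eqF.
  have -> : (f i - f j) * (1 / 2 / dist j) = (f i - f j) / (dist j * 2 ^ 1).
    by rewrite expr1z; field; rewrite gt_eqF.
  apply: (evaluates_div e_lt1 hs (evaluates_mul_pow2 1 hd)).
  by rewrite expr1z mulf_neq0 ?gt_eqF.
have [de ee dc fl [a [b [ha hb ab]]]] := computed_add e_lt1 h1 h2.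
split=> //; last by rewrite /v ab; exact: value_spec_pair.
rewrite ee pair_weightE // block_sum_coef_pair //.
have i0 := dist_gt0 i; have j0 := dist_gt0 j; field.
by rewrite !gt_eqF.
Qed.

End Blocks.

(** * Error of the quotient *)

(** Here [s] stands for sigma_m eps, the error of a summation. *)
Section Errors.
Variables (R : realType) (e s : R).
Hypotheses (e_gt0 : 0 < e) (e_lt1 : e < 1) (s_ge0 : 0 <= s).
Hypothesis small : 20 * e + 202 / 100 * s < 1 / 100.

Let factor_range d : `|d| <= 1 -> 1 - s <= 1 + d * s <= 1 + s.
Proof.
rewrite ler_norml => /andP[d1 d2].
by apply/andP; split; move: s_ge0; nra.
Qed.

(** A sum of positive terms is computed with the relative error of the worst
term, whatever the number of terms; hence the computed denominator, together
with the rounding of the division, acts on the numerator as a factor [q]. *)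
Lemma quotient_factor (m : nat) (W w d : 'I_m -> R) z :
  (forall p, 0 <= W p) -> 0 < \sum_p W p ->
  (forall p, rounding e 6 (w p)) -> (forall p, `|d p| <= 1) ->
  rounding e 1 z ->
  let Dh := \sum_p (1 + d p * s) * (W p * w p) in
  0 < Dh /\ exists q, [/\ z / Dh = q / \sum_p W p, 0 < q,
    1 - 7 * e <= q * (1 + s) & q * (1 - s) * (1 - 7 * e) <= 1].
Proof.
move=> W0 D0 hw hd hz Dh; set D := \sum_p W p in D0 *.
have u0 : 0 < (1 - e) ^+ 6 by rewrite exprn_gt0 // subr_gt0.
have v1 : 1 - 7 * e <= (1 - e) * (1 - e) ^+ 6 := bernoulli e_gt0 e_lt1 7.
have s1 : 0 < 1 - s by move: small e_gt0 s_ge0; lra.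
have z0 := rounding_gt0 e_lt1 hz; case: hz; rewrite expr1 => z1 z2.
have lo : (1 - s) * (1 - e) ^+ 6 * D <= Dh.
  rewrite mulr_sumr; apply: ler_sum => p _.
  rewrite [leRHS](_ : _ = (1 + d p * s) * w p * W p); last by ring.
  rewrite ler_wpM2r //; have /andP[h1 h2] := factor_range (hd p).
  by have [w1 w2] := hw p; rewrite ler_pM // ltW.
have hi : (1 - e) ^+ 6 * Dh <= (1 + s) * D.
  rewrite !mulr_sumr; apply: ler_sum => p _.
  rewrite [leLHS](_ : _ = (1 + d p * s) * ((1 - e) ^+ 6 * w p) * W p); last by ring.
  rewrite ler_wpM2r //; have /andP[h1 h2] := factor_range (hd p).
  have [w1 w2] := hw p; have w0 := rounding_gt0 e_lt1 (hw p).
  rewrite -[leRHS]mulr1; apply: ler_pM => //.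
    by apply: le_trans h1; exact: ltW.
  exact: ltW (mulr_gt0 u0 w0).
have Dh0 : 0 < Dh by apply: lt_le_trans lo; rewrite mulr_gt0 // mulr_gt0.
split=> //; exists (z * D / Dh); split.
- by field; rewrite !gt_eqF.
- by rewrite divr_gt0 ?mulr_gt0.
- rewrite mulrAC ler_pdivlMr //; move: ((1 - e) ^+ 6) u0 v1 lo hi => u u0 v1 lo hi.
  apply: (le_trans (ler_wpM2r (ltW Dh0) v1)).
  rewrite -[X in X <= _]mulrA; apply: (le_trans (y := z * (u * Dh))).
    by rewrite ler_wpM2r // ltW // mulr_gt0.
  by rewrite -mulrA [D * _]mulrC ler_wpM2l // ltW.
- rewrite [leLHS](_ : _ = (1 - 7 * e) * (z * (1 - s) * D) / Dh); last by ring.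
  rewrite ler_pdivrMr // mul1r; move: ((1 - e) ^+ 6) u0 v1 lo hi => u u0 v1 lo hi.
  apply: (le_trans (ler_wpM2r _ v1)); first by rewrite ltW // !mulr_gt0.
  apply: le_trans lo.
  rewrite [leLHS](_ : _ = ((1 - e) * z) * ((1 - s) * u * D)); last by ring.
  by rewrite ler_piMl // ltW // !mulr_gt0.
Qed.

(** The multiplicative error of a node value: the quotient factor [q], the
summation factor [1 + d s] of its block and the roundings [a] of its term; [c]
is the size of the neighbouring value that the roundings mix in. *)
Lemma backward_bound q d a y yh c :
  0 < q -> 1 - 7 * e <= q * (1 + s) -> q * (1 - s) * (1 - 7 * e) <= 1 ->
  `|d| <= 1 -> rounding e 8 a -> 0 <= c -> `|yh - y * a| <= 13 * e * c ->
  `|q * (1 + d * s) * yh - y| <=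
    (166 / 10 * e + 21 / 10 * s) * (`|y| + c).
Proof.
move=> q0 q1 q2 /factor_range/andP[d1 d2] ha c0 hy.
have a0 := rounding_gt0 e_lt1 ha; have [a1 a2] := rounding_linear e_gt0 e_lt1 ha.
move: (1 + d * s) d1 d2 => D d1 d2.
have s1 : s < 1 / 200 by move: small e_gt0; lra.
have e1 : e < 1 / 2000 by move: small s_ge0; lra.
have D0 : 0 < D by apply: lt_le_trans d1; lra.
have qD_hi : q * D * ((1 - s) * (1 - 7 * e)) <= 1 + s.
  rewrite [leLHS](_ : _ = D * (q * (1 - s) * (1 - 7 * e))); last by ring.
  rewrite -[leRHS]mulr1; apply: ler_pM => //; first exact: ltW.
  by rewrite !mulr_ge0 //; move: s1 e1; lra.
have qD_lo : (1 - s) * (1 - 7 * e) <= q * D * (1 + s).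
  rewrite [leRHS](_ : _ = D * (q * (1 + s))); last by ring.
  by apply: ler_pM => //; move: s1 e1; lra.
move: (q * D) (mulr_gt0 q0 D0) qD_hi qD_lo => p p0 p_hi p_lo {q0 q1 q2 d1 d2 D0}.
have p_le : p <= 11 / 10 by move: p_hi p0 s1 e1 s_ge0 e_gt0; nra.
have pa : `|p * a - 1| <= 166 / 10 * e + 21 / 10 * s.
  have hi : p * a * (1 - s - 15 * e) <= 1 + s.
    have h : p * ((1 - s) * (1 - 7 * e)) * ((1 - 8 * e) * a) <= (1 + s) * 1.
      apply: ler_pM => //; rewrite ?mulr_ge0 //; try exact: ltW; move: s1 e1; lra.
    have h' : 1 - s - 15 * e <= (1 - s) * (1 - 7 * e) * (1 - 8 * e).
      by move: s1 e1 s_ge0 e_gt0; nra.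
    apply: le_trans (ler_wpM2l _ h') _; first by rewrite ltW ?mulr_gt0.
    rewrite -[1 + s]mulr1 [leLHS](_ : _ = p * ((1 - s) * (1 - 7 * e)) *
      ((1 - 8 * e) * a)) //; ring.
  have lo : (1 - s) * (1 - 15 * e) <= p * a * (1 + s).
    have h : (1 - s) * (1 - 7 * e) * (1 - 8 * e) <= p * (1 + s) * a.
      by apply: ler_pM => //; rewrite ?mulr_ge0 //; move: s1 e1; lra.
    have h' : (1 - s) * (1 - 15 * e) <= (1 - s) * (1 - 7 * e) * (1 - 8 * e).
      by move: s1 e1 s_ge0 e_gt0; nra.
    by apply: (le_trans h'); apply: (le_trans h); rewrite mulrAC.
  move: (p * a) (mulr_gt0 p0 a0) hi lo => r r0 hi lo.
  set K := 166 / 10 * e + 21 / 10 * s.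
  have K0 : 0 <= K by rewrite /K; move: s_ge0 e_gt0; lra.
  have T_le : s + 15 * e <= 1 / 100 by move: small s_ge0 e_gt0; lra.
  have KT := ler_wpM2l K0 T_le.
  have Ks := mulr_ge0 K0 s_ge0; have es := mulr_ge0 (ltW e_gt0) s_ge0.
  rewrite ler_norml lerBlDl lerBrDl; apply/andP; split.
    have s2 : 0 < 1 + s by move: s_ge0; lra.
    rewrite -(ler_pM2r s2); apply: le_trans lo.
    by rewrite /K in Ks *; move: s_ge0 e_gt0; lra.
  have T1 : 0 < 1 - s - 15 * e by move: T_le; lra.
  rewrite -(ler_pM2r T1); apply: (le_trans hi).
  by rewrite /K in KT *; move: s_ge0 e_gt0; lra.
rewrite [X in `|X|](_ : _ = p * (yh - y * a) + y * (p * a - 1)); last by ring.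
apply: (le_trans (ler_normD _ _)); rewrite !normrM (gtr0_norm p0).
have h1 : p * `|yh - y * a| <= (166 / 10 * e + 21 / 10 * s) * c.
  apply: (le_trans (ler_pM (ltW p0) (normr_ge0 _) p_le hy)).
  by rewrite !mulrA ler_wpM2r //; move: s_ge0 e_gt0; lra.
have h2 := ler_wpM2l (normr_ge0 y) pa.
rewrite [leRHS]mulrDr [leLHS]addrC; apply: lerD => //.
by rewrite [leRHS]mulrC.
Qed.

(** The errors are bounded blockwise by multiples of the weights [W p], so their
sum is at most the same multiple of the denominator. *)
Lemma forward_bound (m : nat) (W V Vh d : 'I_m -> R) q F G :
  let D := \sum_p W p in
  (forall p, 0 <= W p) -> 0 < D -> 0 <= F -> 0 <= G ->
  (forall p, `|d p| <= 1) ->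
  (forall p, `|V p| <= W p * (F + 2 * G)) ->
  (forall p, `|Vh p - V p| <= W p * (9 * F + 9 * G) * e) ->
  0 < q -> 1 - 7 * e <= q * (1 + s) -> q * (1 - s) * (1 - 7 * e) <= 1 ->
  `|(\sum_p (1 + d p * s) * Vh p) * q / D - (\sum_p V p) / D| <=
    (456 / 10 * F + 374 / 10 * G) * e + (62 / 10 * F + 41 / 10 * G) * s.
Proof.
move=> D W0 D0 F0 G0 hd hV hVh q0 q1 q2.
have s1 : s < 1 / 200 by move: small e_gt0; lra.
have e1 : e < 1 / 2000 by move: small s_ge0; lra.
pose E := 181 / 20 * (F + G) * e + s * (F + 2 * G).
have hN : `|(\sum_p (1 + d p * s) * Vh p) - \sum_p V p| <= D * E.
  rewrite -sumrB mulr_suml; apply: (le_trans (ler_norm_sum _ _ _)).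
  apply: ler_sum => p _.
  rewrite [X in `|X|](_ : _ = (1 + d p * s) * (Vh p - V p) + d p * s * V p); last by ring.
  apply: (le_trans (ler_normD _ _)); rewrite !normrM (ger0_norm s_ge0).
  have /andP[f1 f2] := factor_range (hd p).
  have f3 : `|1 + d p * s| <= 201 / 200 by rewrite ger0_norm; move: s1; lra.
  have h1 := ler_pM (normr_ge0 _) (normr_ge0 _) f3 (hVh p).
  have ds : `|d p| * s <= s by rewrite ler_piMl.
  have h2 : `|d p| * s * `|V p| <= s * (W p * (F + 2 * G)).
    by apply: ler_pM => //; rewrite mulr_ge0.
  apply: (le_trans (lerD h1 h2)).
  rewrite [leLHS](_ : _ = W p * (1809 / 200 * (F + G) * e + s * (F + 2 * G))); last by field.
  apply: ler_wpM2l => //; rewrite lerD2r.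
  apply: (ler_wpM2r (ltW e_gt0)); apply: (ler_wpM2r (addr_ge0 F0 G0)).
  by lra.
have hV' : `|\sum_p V p| <= D * (F + 2 * G).
  by rewrite mulr_suml; apply: (le_trans (ler_norm_sum _ _ _)); apply: ler_sum.
have q_le : q <= 91 / 90 by move: q2 q0 s1 e1 s_ge0 e_gt0 small; nra.
have q_dist : `|q - 1| <= 91 / 90 * (s + 7 * e).
  by rewrite ler_norml; apply/andP; split; move: small s_ge0 e_gt0 s1 e1; nra.
move: (\sum_p V p) (\sum_p _ * _) hN hV' => N Nh hN hV'.
rewrite -mulrBl normrM normfV (gtr0_norm D0) ler_pdivrMr //.
rewrite [X in `|X|](_ : _ = (Nh - N) * q + N * (q - 1)); last by ring.
apply: (le_trans (ler_normD _ _)); rewrite !normrM (gtr0_norm q0).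
have h1 := ler_pM (normr_ge0 _) (ltW q0) hN q_le.
have h2 := ler_pM (normr_ge0 _) (normr_ge0 _) hV' q_dist.
apply: (le_trans (lerD h1 h2)); rewrite [leRHS]mulrC -!mulrA -mulrDr ler_wpM2l ?(ltW D0) //.
have Fe := mulr_ge0 F0 (ltW e_gt0); have Ge := mulr_ge0 G0 (ltW e_gt0).
have Fs := mulr_ge0 F0 s_ge0; have Gs := mulr_ge0 G0 s_ge0.
by rewrite /E; lra.
Qed.

End Errors.

(** * The scheme and its errors *)

Definition scheme (n k : nat) : expr n :=
  EOp Div
    (ESum (fun p : 'I_((n + 1) %/ 2).+1 => block_value k (block_of n k p)))
    (ESum (fun p : 'I_((n + 1) %/ 2).+1 => block_weight k (block_of n k p))).

Lemma baryE (R : realType) (n k : nat) (x : 'I_n.+1 -> R) (t : R) (f : 'I_n.+1 -> R) :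
  bary x t f = (\sum_i coef k t x i * f i) / (\sum_i coef k t x i).
Proof.
rewrite /bary /coef -mulr_sumr.
have -> : \sum_i (-1) ^+ k * (weight R i / (t - x i)) * f i =
          (-1) ^+ k * \sum_i weight R i * f i / (t - x i).
  by rewrite mulr_sumr; apply: eq_bigr => i _; ring.
by rewrite -mulf_div divff ?signr_eq0 // mul1r.
Qed.

Theorem theorem2 (R : realType) (n : nat) (n_ge2 : (2 <= n)%N) :
  exists P : 'I_n -> expr n,
  forall (M : fp_arith R) (x : 'I_n.+1 -> R),
    let m := ((n + 1) %/ 2)%N in
    (forall i, float M (x i)) ->
    x ord0 = -1 -> x ord_max = 1 ->
    (forall i j : 'I_n.+1, (i < j)%N -> x i < x j) ->
    (20 + 202 / 100 * sigma M m) * eps M < 1 / 100 ->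
    float M (2 + x (inord 1)) ->
    float M (2 - x (inord (n - 1))) ->
    (forall i : nat, (1 <= i <= n - 1)%N ->
      float M (x (inord i) + x (inord (i - 1)))) ->
  forall (t : R) (f : 'I_n.+1 -> R),
    float M t -> (forall i, float M (f i)) ->
    -1 <= t <= 1 -> (forall i, t <> x i) ->
  exists k : 'I_n,
    let computed := eval (computed_arith M) t x f (P k) in
    [/\ x (inord k) < t < x (inord k.+1),
        defined (exact_arith R) t x f (P k) /\
          eval (exact_arith R) t x f (P k) = bary x t f,
        defined (computed_arith M) t x f (P k),
        exists2 fhat : 'I_n.+1 -> R,
          computed = bary x t fhat &
          forall i : 'I_n.+1,
            `|fhat i - f i| <=
              (166 / 10 + 21 / 10 * sigma M m) *
              Num.max (`|prev_value f i| + `|f i|)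
                      (`|f i| + `|next_value f i|) * eps M &
        `|computed - bary x t f| <=
          (456 / 10 * sup_norm f
           + 374 / 10 * sup_norm (divided_diff x f)
           + 62 / 10 * sup_norm f * sigma M m
           + 41 / 10 * sup_norm (divided_diff x f) * sigma M m) * eps M].
Proof.
have nm : (n < ((n + 1) %/ 2).+1.*2 - 1)%N by lia.
have km (k : nat) : (k < n)%N -> (block_index k k < ((n + 1) %/ 2).+1)%N.
  by rewrite /block_index; lia.
exists (fun k => scheme n k) => M x m x_float x0 xn x_incr small _ _ _ t f.
move=> t_float f_float /andP[t_ge t_le] t_node.
have e_gt0 : 0 < eps M by exact: eps_gt0.
have sigma1 : 1 <= sigma M m by exact: sigma_ge1.
set s := sigma M m * eps M.
have s_ge : eps M <= s by rewrite ler_peMl // ltW.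
have small' : 20 * eps M + 202 / 100 * s < 1 / 100.
  rewrite [X in X < _](_ : _ = (20 + 202 / 100 * sigma M m) * eps M) //.
  by rewrite /s; ring.
have eps_small : 22 * eps M < 1 / 100 by lra.
have e_lt1 : eps M < 1 by lra.
have s_ge0 : 0 <= s by lra.
have x_nd (i j : 'I_n.+1) : (i <= j)%N -> x i <= x j.
  rewrite leq_eqVlt => /orP[/eqP/val_inj -> //|/x_incr]; exact: ltW.
have x_le1 i : `|x i| <= 1.
  by rewrite ler_norml -x0 -xn !x_nd //= -ltnS.
have t_le1 : `|t| <= 1 by rewrite ler_norml t_ge.
have [k kt] : exists k : 'I_n, x (inord k) < t < x (inord k.+1).
  by apply: between_nodes => //; rewrite x0 xn t_ge.
exists k; have kn := ltn_ord k; have /andP[k_lt k_gt] := kt.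
have x_left (i : 'I_n.+1) : (i <= k)%N -> x i < t.
  by move=> ik; apply: le_lt_trans k_lt; apply: x_nd; rewrite inordK // ltnS ltnW.
have x_right (i : 'I_n.+1) : (k < i)%N -> t < x i.
  by move=> ki; apply: lt_le_trans k_gt _; apply: x_nd; rewrite inordK.
pose c := coef k t x; pose g (p : 'I_m.+1) := block_of n k p.
have alt p : alternating k (g p) by exact: block_of_alternating.
have hW p := evaluates_block_weight f x_left x_right x_incr eps_small t_float
  x_float (alt p).
have hV p := block_valueP x_left x_right x_incr eps_small t_float x_float f_float
  x_le1 t_le1 (alt p).
pose W p := block_sum (g p) c; pose V p := block_sum (g p) (fun i => c i * f i).
have W0 p : 0 <= W p by apply: block_weight_ge0.
have sumW : \sum_i c i = \sum_p W p by exact: sum_blocks.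
have sumV : \sum_i c i * f i = \sum_p V p by exact: sum_blocks.
have D0 : 0 < \sum_p W p.
  pose p0 : 'I_m.+1 := inord (block_index k k).
  have p0E : p0 = block_index k k :> nat.
    by rewrite inordK ?km.
  rewrite (bigD1 p0) //= ltr_pwDl ?sumr_ge0 //.
  apply: block_weight_gt0 => //.
  by rewrite /g p0E; exact: block_of_index.
have /fin_all_exists2[w hw wE] p : exists2 w, rounding (eps M) 6 w &
    eval (computed_arith M) t x f (block_weight k (g p)) = W p * w.
  by case: (hW p) => _ _ _ _ [z]; exists z.
pose Vh p := eval (computed_arith M) t x f (block_value k (g p)).
have /fin_all_exists2[ft ftE fta] p : exists2 ft : 'I_n.+1 -> R,
    Vh p = block_sum (g p) (fun i => c i * ft i) &
    forall i, exists2 a, rounding (eps M) 8 a & `|ft i - f i * a| <=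
      13 * eps M * Num.max `|prev_value f i| `|next_value f i|.
  by case: (hV p) => _ _ _ _ [_ _].
have V_le p : `|V p| <= W p * (sup_norm f + 2 * sup_norm (divided_diff x f)).
  by case: (hV p) => _ _ _ _ [].
have Vh_le p : `|Vh p - V p| <=
    W p * (9 * sup_norm f + 9 * sup_norm (divided_diff x f)) * eps M.
  by case: (hV p) => _ _ _ _ [].
have Vfl p : float M (Vh p) by case: (hV p).
have Wfl p : float M (eval (computed_arith M) t x f (block_weight k (g p))).
  by case: (hW p).
have [d d1 dE] := flsum_error Vfl; have [d' d'1 d'E] := flsum_error Wfl.
set Dh := LHS in d'E.
have DhE : Dh = \sum_p (1 + d' p * s) * (W p * w p).
  by rewrite d'E; apply: eq_bigr => p _; rewrite wE /s [d' p * (_ * _)]mulrA.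
have Dh0 : 0 < Dh.
  rewrite DhE.
  by have [? _] := quotient_factor e_gt0 e_lt1 s_ge0 small' W0 D0 hw d'1
    (rounding1 e_gt0 e_lt1 1).
have nzD : Div = Div -> Dh <> 0 by move=> _; apply/eqP; rewrite gt_eqF.
have [z hz fE] := fl_error (o := Div) (float_flsum Vfl) (float_flsum Wfl) nzD.
have hz' := rounding_Erho e_lt1 hz.
have [_ [q [qE q0 q1 q2]]] := quotient_factor e_gt0 e_lt1 s_ge0 small' W0 D0 hw
  d'1 hz'.
set computed := eval _ _ _ _ _.
have cE : computed = (\sum_p (1 + d p * s) * Vh p) * q / \sum_p W p.
  rewrite /computed /= -/Dh fE /= dE -/Dh.
  rewrite -mulrA [_^-1 * z]mulrC DhE qE mulrA; congr (_ * _ / _).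
  by apply: eq_bigr => p _; rewrite /s [d p * (_ * _)]mulrA.
split=> //.
- split.
    split=> /= [p|p|_].
    + by case: (hV p).
    + by case: (hW p).
    rewrite (eq_bigr W) => [|p _]; first by apply/eqP; rewrite gt_eqF.
    by case: (hW p).
  rewrite (baryE k) -/c sumV sumW /=; congr (_ / _); apply: eq_bigr => p _.
    by case: (hV p).
  by case: (hW p).
- by split=> /= [p|p|//]; [case: (hV p) | case: (hW p)].
- (* The values of a block share its summation error and the factor q. *)
  pose ix (i : 'I_n.+1) : 'I_m.+1 := inord (block_index k i).
  exists (fun i => q * (1 + d (ix i) * s) * ft (ix i) i).
    rewrite (baryE k) -/c sumW cE; congr (_ / _).
    rewrite (sum_blocks _ kn nm) mulr_suml; apply: eq_bigr => p _.
    rewrite ftE -!block_sumE // mulr_sumr mulr_suml; apply: eq_bigr => i /eqP ip.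
    by rewrite /ix ip inord_val; ring.
  move=> i; have [a ha hfta] := fta (ix i) i.
  have N0 : 0 <= Num.max `|prev_value f i| `|next_value f i|.
    by rewrite le_max normr_ge0.
  apply: (le_trans (backward_bound e_gt0 e_lt1 s_ge0 small' q0 q1 q2
    (d1 (ix i)) ha N0 hfta)).
  rewrite [leRHS]mulrAC [X in _ <= X * _](_ : _ =
    166 / 10 * eps M + 21 / 10 * s); last by rewrite /s; ring.
  by rewrite addr_maxr [`|f i| + `|prev_value f i|]addrC.
- rewrite cE (baryE k) -/c sumV sumW.
  apply: (le_trans (forward_bound e_gt0 s_ge0 small' W0 D0
    (sup_norm_ge0 f) (sup_norm_ge0 (divided_diff x f)) d1 V_le Vh_le q0 q1 q2)).
  rewrite [leLHS](_ : _ = (456 / 10 * sup_norm f +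
    374 / 10 * sup_norm (divided_diff x f) +
    62 / 10 * sup_norm f * sigma M m +
    41 / 10 * sup_norm (divided_diff x f) * sigma M m) * eps M) //.
  by rewrite /s; ring.
Qed.
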